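(* For $\lambda,\mu>0$ let $$H(\lambda,\mu)=\mu\lambda\ln\lambda-(1+\mu\lambda)\ln\left(\frac{1+\mu\lambda}{1+\mu}\right).$$ Then: 1. For all $\mu>0$ and $\lambda\in(0,1]$, $H(\lambda,\mu)\ge\frac{\mu}{2(1+\mu)}\cdot(\lambda-1)^2$. 2. For all $\mu>0$ and $\lambda\in[1,2]$, $H(\lambda,\mu)\ge\frac{\mu}{4(1+\mu)}\cdot(\lambda-1)^2$. 3. For all $\mu>0$ and $\lambda\ge2$, $H(\lambda,\mu)\ge\frac{\mu}{4(1+\mu)}\cdot(\lambda-1)$. 4. For all $0<\mu\le\frac13$ and $\lambda\ge3$, $H(\lambda,\mu)\ge\frac{\mu\lambda}{4}\cdot\ln\left(\min\left\{\lambda,\frac1\mu\right\}\right)$. 5. For all $0<\lambda\le\frac13$ and $\mu\ge3$, $H(\lambda,\mu)\ge\frac14\cdot\ln\left(\min\left\{\frac1\lambda,\mu\right\}\right)$.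
   Context: $\lambda$ and $\mu$ are real numbers and $\ln$ is the natural logarithm. *)

(* Defs.v *)
From Stdlib Require Export Reals.

Open Scope R_scope.

Definition H (lambda mu : R) : R :=
  mu * lambda * ln lambda
  - (1 + mu * lambda) * ln ((1 + mu * lambda) / (1 + mu)).

(* Main.v *)
Require Import Defs.
From Stdlib Require Import Reals Lra.
From Coquelicot Require Import Coquelicot.

Open Scope R_scope.

(** Writing [a = mu * lambda], [H lambda mu] is [1 + a] times the
    Kullback-Leibler divergence between the Bernoulli laws with odds [a] and
    [mu].  The proof uses it in two ways.

    Near [lambda = 1] the bounds come from the derivative.  Both [H] and its
    [lambda]-derivative [mu * ln (lambda * (1 + mu) / (1 + mu * lambda))] vanish
    at [lambda = 1], and the inequalities [1 - 1 / y <= ln y <= y - 1] compare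
    that derivative with the derivative of the quadratic lower bound
    ([H_quadratic_below_1], [H_quadratic_above_1]).

    Away from [1] the bounds come from the dual description of the divergence as
    a supremum of functions affine in [lambda], one for each [x > 0], attained at
    [x = lambda] ([H_ge_supporting_line]).  The line for [x = 2] extends the
    quadratic bound linearly.  When [mu * lambda >= 1], the line for
    [x = 1 / mu] gives
      [H lambda mu >= mu * lambda * (ln m - 2 * ln (2 * m / (1 + m)))]
    with [m = 1 / mu].  When [mu * lambda <= 1], concavity of [ln] gives the same
    bound with [m = lambda].  So in both cases [m] is the minimum of [lambda]
    and [1 / mu], and it remains to see that the parenthesis is at least
    [ln m / 4] for [m >= 3] ([ln_corner]).  The constant leaves little room:
    at [m = 3] this compares [4 ^ 8 = 65536] with [256 * 3 ^ 5 = 62208].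

    Inverting both arguments divides [H] by their product ([H_inv]), which turns
    the regime of small [lambda] and large [mu] into the one just treated. *)

(** * Elementary logarithmic inequalities *)

Lemma ln_le_sub_1 (y : R) : 0 < y -> ln y <= y - 1.
Proof.
intros Hy. pose proof (exp_ineq1_le (ln y)) as He.
rewrite exp_ln in He by assumption. lra.
Qed.

Lemma ln_ge_1_sub_inv (y : R) : 0 < y -> 1 - / y <= ln y.
Proof.
intros Hy. pose proof (ln_le_sub_1 (/ y) (Rinv_0_lt_compat _ Hy)) as He.
rewrite ln_Rinv in He by assumption. lra.
Qed.

Lemma ln_tangent (w z : R) : 0 < w -> 0 < z -> ln w <= ln z + (w - z) / z.
Proof.
intros Hw Hz.
pose proof (ln_le_sub_1 (w / z) (Rdiv_lt_0_compat _ _ Hw Hz)) as He.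
rewrite ln_div in He by assumption.
replace ((w - z) / z) with (w / z - 1) by (field; lra). lra.
Qed.

(** After exponentiation this is [256 * x ^ 5 <= (1 + x) ^ 8], and the difference
    of the two sides has nonnegative coefficients in powers of [x - 3]. *)
Lemma ln_corner (x : R) : 3 <= x -> 2 * ln (2 * x / (1 + x)) <= 3 / 4 * ln x.
Proof.
intros Hx.
assert (Hpoly : 256 * x ^ 5 <= (1 + x) ^ 8).
{ set (t := x - 3). assert (Ht : 0 <= t) by (unfold t; lra).
  replace x with (3 + t) by (unfold t; ring).
  assert (forall n, 0 <= t ^ n) as Hp by (intros n; apply pow_le; exact Ht).
  pose proof (Hp 1%nat); pose proof (Hp 2%nat); pose proof (Hp 3%nat);
  pose proof (Hp 4%nat); pose proof (Hp 5%nat); pose proof (Hp 6%nat);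
  pose proof (Hp 7%nat); pose proof (Hp 8%nat).
  ring_simplify. lra. }
assert (Hln : ln (256 * x ^ 5) <= ln ((1 + x) ^ 8)).
{ apply ln_le; [|exact Hpoly].
  apply Rmult_lt_0_compat; [lra | apply pow_lt; lra]. }
rewrite ln_mult, !ln_pow in Hln by (try apply pow_lt; lra).
replace 256 with (2 ^ 8) in Hln by ring.
rewrite ln_pow in Hln by lra. simpl INR in Hln.
rewrite ln_div, ln_mult by lra. lra.
Qed.

(** * The function in its first variable *)

Lemma H_expand (l mu : R) : 0 < l -> 0 < mu ->
  H l mu = mu * l * ln l - (1 + mu * l) * (ln (1 + mu * l) - ln (1 + mu)).
Proof.
intros Hl Hmu. unfold H. rewrite ln_div; [reflexivity | nra | lra].
Qed.

Lemma H_1 (mu : R) : 0 < mu -> H 1 mu = 0.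
Proof.
intros Hmu. rewrite H_expand by lra. rewrite ln_1, !Rmult_1_r. ring.
Qed.

Lemma H_minus_quadratic_derivative (c l mu : R) : 0 < l -> 0 < mu ->
  derivable_pt_lim (fun l => H l mu - c * (l - 1) ^ 2) l
    (mu * ln (l * (1 + mu) / (1 + mu * l)) - 2 * c * (l - 1)).
Proof.
intros Hl Hmu. assert (Ha : 0 < 1 + mu * l) by nra.
assert (Hq : 0 < (1 + mu * l) / (1 + mu)) by (apply Rdiv_lt_0_compat; lra).
apply is_derive_Reals. unfold H. auto_derive.
- repeat split; assumption.
- fold ((1 + mu * l) / (1 + mu)).
  rewrite !ln_div, ln_mult by nra. field. lra.
Qed.

(** Here [ln y <= y - 1] bounds the derivative of [H] from above by
    [mu * (l - 1) / (1 + mu * l)], and the numerator is negative, so enlarging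
    the denominator to [1 + mu] weakens the bound. *)
Lemma H_quadratic_below_1 (l mu : R) : 0 < mu -> 0 < l <= 1 ->
  mu / (2 * (1 + mu)) * (l - 1) ^ 2 <= H l mu.
Proof.
intros Hmu [Hl0 Hl1]. destruct (Rle_lt_or_eq_dec _ _ Hl1) as [Hl | ->].
2:{ rewrite H_1 by assumption. lra. }
set (c := mu / (2 * (1 + mu))).
destruct (MVT_cor2 (fun l => H l mu - c * (l - 1) ^ 2)
  (fun l => mu * ln (l * (1 + mu) / (1 + mu * l)) - 2 * c * (l - 1)) l 1 Hl)
  as [x [Heq Hx]].
{ intros x Hx. apply H_minus_quadratic_derivative; lra. }
rewrite H_1 in Heq by assumption.
assert (Ha : 0 < 1 + mu * x) by nra.
assert (Hd : mu * ln (x * (1 + mu) / (1 + mu * x)) <= 2 * c * (x - 1)).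
{ assert (Hy : 0 < x * (1 + mu) / (1 + mu * x))
    by (apply Rdiv_lt_0_compat; nra).
  pose proof (ln_le_sub_1 _ Hy) as Hln.
  assert (Hgap : (x - 1) / (1 + mu) - (x * (1 + mu) / (1 + mu * x) - 1)
                 = mu * (1 - x) ^ 2 / ((1 + mu) * (1 + mu * x)))
    by (field; lra).
  assert (0 <= mu * (1 - x) ^ 2 / ((1 + mu) * (1 + mu * x))).
  { apply Rdiv_le_0_compat;
      [apply Rmult_le_pos; [lra | apply pow2_ge_0] | nra]. }
  replace (2 * c * (x - 1)) with (mu * ((x - 1) / (1 + mu)))
    by (unfold c; field; lra).
  apply Rmult_le_compat_l; lra. }
nra.
Qed.

(** Here [1 - 1 / y <= ln y] bounds the derivative of [H] from below by
    [mu * (l - 1) / (l * (1 + mu))]; the restriction [l <= 2] makes the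
    denominator at most [2 * (1 + mu)]. *)
Lemma H_quadratic_above_1 (l mu : R) : 0 < mu -> 1 <= l <= 2 ->
  mu / (4 * (1 + mu)) * (l - 1) ^ 2 <= H l mu.
Proof.
intros Hmu [Hl1 Hl2]. destruct (Rle_lt_or_eq_dec _ _ Hl1) as [Hl | <-].
2:{ rewrite H_1 by assumption. lra. }
set (c := mu / (4 * (1 + mu))).
destruct (MVT_cor2 (fun l => H l mu - c * (l - 1) ^ 2)
  (fun l => mu * ln (l * (1 + mu) / (1 + mu * l)) - 2 * c * (l - 1)) 1 l Hl)
  as [x [Heq Hx]].
{ intros x Hx. apply H_minus_quadratic_derivative; lra. }
rewrite H_1 in Heq by assumption.
assert (Ha : 0 < 1 + mu * x) by nra.
assert (Hd : 2 * c * (x - 1) <= mu * ln (x * (1 + mu) / (1 + mu * x))).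
{ assert (Hy : 0 < x * (1 + mu) / (1 + mu * x))
    by (apply Rdiv_lt_0_compat; nra).
  pose proof (ln_ge_1_sub_inv _ Hy) as Hln.
  assert (Hgap : 1 - / (x * (1 + mu) / (1 + mu * x))
                 - (x - 1) / (2 * (1 + mu))
                 = (x - 1) * (2 - x) / (2 * x * (1 + mu)))
    by (field; lra).
  assert (0 <= (x - 1) * (2 - x) / (2 * x * (1 + mu))).
  { apply Rdiv_le_0_compat; nra. }
  replace (2 * c * (x - 1)) with (mu * ((x - 1) / (2 * (1 + mu))))
    by (unfold c; field; lra).
  apply Rmult_le_compat_l; lra. }
nra.
Qed.

(** * Supporting lines *)

(** The right-hand side is the tangent to [H] at [lambda = x].  The difference of
    the two sides is a relative entropy of masses [(mu * l, 1)] with respect to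
    [(mu * x / w, 1 / w)], where [w] makes the totals equal; it is nonnegative by
    [1 - 1 / y <= ln y] in each coordinate. *)
Lemma H_ge_supporting_line (l mu x : R) : 0 < l -> 0 < mu -> 0 < x ->
  mu * l * ln x - (1 + mu * l) * ln ((1 + mu * x) / (1 + mu)) <= H l mu.
Proof.
intros Hl Hmu Hx. rewrite H_expand by assumption.
assert (Ha : 0 < mu * l) by nra. assert (Hb : 0 < mu * x) by nra.
set (w := (1 + mu * x) / (1 + mu * l)).
assert (Hw : 0 < w) by (apply Rdiv_lt_0_compat; lra).
pose proof (ln_ge_1_sub_inv w Hw) as H1.
assert (Hy : 0 < w * l / x) by (apply Rdiv_lt_0_compat; nra).
pose proof (ln_ge_1_sub_inv _ Hy) as H2.
apply (Rmult_le_compat_l (mu * l)) in H2; [|lra].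
(* The first-order terms cancel: this is the equality of total masses. *)
assert (Hsum : mu * l * (1 - / (w * l / x)) + (1 - / w) = 0)
  by (unfold w; field; repeat split; nra).
rewrite !ln_div, ?ln_mult in H2 by nra.
unfold w in H1, H2. rewrite ln_div in H1, H2 by lra.
rewrite ln_div by lra. fold w in H1, H2. nra.
Qed.

(** The supporting line at [2] is nonpositive at [1], where [H] vanishes, so
    beyond [2] it stays above the chord from [1] to [2]; the quadratic bound at
    [2] controls the slope of that chord. *)
Lemma H_linear_above_2 (l mu : R) : 0 < mu -> 2 <= l ->
  mu / (4 * (1 + mu)) * (l - 1) <= H l mu.
Proof.
intros Hmu Hl.
assert (Hline := H_ge_supporting_line l mu 2 ltac:(lra) Hmu ltac:(lra)).
assert (Hone := H_ge_supporting_line 1 mu 2 ltac:(lra) Hmu ltac:(lra)).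
rewrite H_1 in Hone by assumption.
assert (Htwo := H_quadratic_above_1 2 mu Hmu ltac:(lra)).
unfold H in Htwo.
set (A := ln 2) in *. set (B := ln ((1 + mu * 2) / (1 + mu))) in *.
set (c := mu / (4 * (1 + mu))) in *.
nra.
Qed.

(** * Large first argument, small second argument *)

(** Concavity of [ln] for [(1 + mu) / (1 + a)], with [a = mu * l], written as the
    average of [1] and [(1 + l) / (2 * l)] with weights proportional to [1 - a]
    and [2 * a]. *)
Lemma H_ge_corner_of_le_1 (l mu : R) : 0 < l -> 0 < mu -> mu * l <= 1 ->
  mu * l * (ln l - 2 * ln (2 * l / (1 + l))) <= H l mu.
Proof.
intros Hl Hmu Ha1. assert (Ha : 0 < mu * l) by nra.
set (z := (1 + mu) / (1 + mu * l)).
assert (Hz : 0 < z) by (apply Rdiv_lt_0_compat; lra).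
set (v := (1 + l) / (2 * l)).
assert (Hv : 0 < v) by (apply Rdiv_lt_0_compat; lra).
pose proof (ln_tangent 1 z Rlt_0_1 Hz) as T1. rewrite ln_1 in T1.
pose proof (ln_tangent v z Hv Hz) as T2.
apply (Rmult_le_compat_l (1 - mu * l)) in T1; [|lra].
apply (Rmult_le_compat_l (2 * (mu * l))) in T2; [|lra].
(* [z] is the weighted mean of [1] and [v], so the tangent terms cancel. *)
assert (Hbal : (1 - mu * l) * ((1 - z) / z)
               + 2 * (mu * l) * ((v - z) / z) = 0)
  by (unfold v, z; field; lra).
assert (Hlz : ln z = - ln ((1 + mu * l) / (1 + mu)))
  by (unfold z; rewrite !ln_div by lra; ring).
assert (Hlv : ln v = - ln (2 * l / (1 + l)))
  by (unfold v; rewrite !ln_div by lra; ring).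
rewrite Hlz in T1, T2. rewrite Hlv in T2. unfold H. lra.
Qed.

Lemma H_ge_corner_of_ge_1 (l mu : R) : 0 < l -> 0 < mu <= 1 -> 1 <= mu * l ->
  mu * l * (ln (1 / mu) - 2 * ln (2 * (1 / mu) / (1 + 1 / mu))) <= H l mu.
Proof.
intros Hl [Hmu Hmu1] Ha.
assert (Hn : 0 < 1 / mu) by (apply Rdiv_lt_0_compat; lra).
assert (Hline := H_ge_supporting_line l mu (1 / mu) Hl Hmu Hn).
replace ((1 + mu * (1 / mu)) / (1 + mu))
  with (2 * (1 / mu) / (1 + 1 / mu)) in Hline by (field; lra).
assert (Hpos : 0 <= ln (2 * (1 / mu) / (1 + 1 / mu))).
{ rewrite <- ln_1. apply ln_le; [lra|].
  replace (2 * (1 / mu) / (1 + 1 / mu)) with (2 / (1 + mu)) by (field; lra).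
  apply Rmult_le_reg_r with (1 + mu); [lra|].
  unfold Rdiv. rewrite Rmult_assoc, Rinv_l by lra. lra. }
nra.
Qed.

Lemma H_ge_ln_min (l mu : R) : 0 < mu <= 1 / 3 -> 3 <= l ->
  mu * l / 4 * ln (Rmin l (1 / mu)) <= H l mu.
Proof.
intros [Hmu Hmu3] Hl. assert (Ha : 0 < mu * l) by nra.
assert (Hinv : mu * (1 / mu) = 1) by (field; lra).
destruct (Rle_dec (mu * l) 1) as [Hle | Hgt].
- rewrite Rmin_left by nra.
  pose proof (H_ge_corner_of_le_1 l mu ltac:(lra) Hmu Hle) as HH.
  pose proof (ln_corner l Hl) as Hc. nra.
- rewrite Rmin_right by nra.
  pose proof (H_ge_corner_of_ge_1 l mu ltac:(lra) ltac:(lra) ltac:(lra)) as HH.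
  pose proof (ln_corner (1 / mu) ltac:(nra)) as Hc. nra.
Qed.

(** * Inversion of both arguments *)

(** Inverting the odds [mu * l] and [mu] exchanges the two outcomes of both
    Bernoulli laws, which leaves their divergence unchanged; only the factor
    [1 + mu * l] becomes [1 + 1 / (mu * l)]. *)
Lemma H_inv (l mu : R) : 0 < l -> 0 < mu ->
  H (1 / l) (1 / mu) = H l mu / (mu * l).
Proof.
intros Hl Hmu. assert (Ha : 0 < mu * l) by nra. unfold H.
replace ((1 + 1 / mu * (1 / l)) / (1 + 1 / mu))
  with ((1 + mu * l) / (1 + mu) / l) by (field; lra).
rewrite (ln_div 1 l), (ln_div _ l), ln_1 by (try apply Rdiv_lt_0_compat; lra).
field. lra.
Qed.

Theorem proposition1 :
  (forall lambda mu : R, 0 < mu -> 0 < lambda <= 1 ->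
     H lambda mu >= mu / (2 * (1 + mu)) * (lambda - 1) ^ 2) /\
  (forall lambda mu : R, 0 < mu -> 1 <= lambda <= 2 ->
     H lambda mu >= mu / (4 * (1 + mu)) * (lambda - 1) ^ 2) /\
  (forall lambda mu : R, 0 < mu -> 2 <= lambda ->
     H lambda mu >= mu / (4 * (1 + mu)) * (lambda - 1)) /\
  (forall lambda mu : R, 0 < mu <= 1 / 3 -> 3 <= lambda ->
     H lambda mu >= mu * lambda / 4 * ln (Rmin lambda (1 / mu))) /\
  (forall lambda mu : R, 0 < lambda <= 1 / 3 -> 3 <= mu ->
     H lambda mu >= 1 / 4 * ln (Rmin (1 / lambda) mu)).
Proof.
repeat split; intros l mu.
- intros Hmu Hl. apply Rle_ge, H_quadratic_below_1; assumption.
- intros Hmu Hl. apply Rle_ge, H_quadratic_above_1; assumption.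
- intros Hmu Hl. apply Rle_ge, H_linear_above_2; assumption.
- intros Hmu Hl. apply Rle_ge, H_ge_ln_min; assumption.
- intros [Hl Hl3] Hmu. apply Rle_ge.
  set (L := 1 / l). set (M := 1 / mu).
  assert (HlL : l = 1 / L) by (unfold L; field; lra).
  assert (HmM : mu = 1 / M) by (unfold M; field; lra).
  assert (HLl : L * l = 1) by (unfold L; field; lra).
  assert (HMm : M * mu = 1) by (unfold M; field; lra).
  assert (HM : 0 < M) by (unfold M; apply Rdiv_lt_0_compat; lra).
  assert (HL : 3 <= L) by nra.
  rewrite HlL, HmM, H_inv by lra.
  assert (HH := H_ge_ln_min L M ltac:(nra) HL).
  apply Rmult_le_reg_l with (M * L); [nra|].
  replace (M * L * (H L M / (M * L))) with (H L M) by (field; lra).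
  lra.
Qed.
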